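(* Let $\Gamma=(P,\mathcal{L})$ be a point-line geometry satisfying the Exchange Property (EP). If a well ordered chain of subspaces of $\Gamma$ is maximal as a member of $\mathfrak{W}(\Gamma)$, then it is maximal in $\mathfrak{C}(\Gamma)$ too.
   Context: A point-line geometry is a pair $\Gamma=(P,\mathcal{L})$ where $P$ (points) is a non-empty set and $\mathcal{L}$ (lines) is a family of subsets of $P$, each containing at least two points. A subspace of $\Gamma$ is a subset $S\subseteq P$ such that every line meeting $S$ in at least two points is contained in $S$ (so $\emptyset$ and $P$ are subspaces). For $X\subseteq P$, $\langle X\rangle$ is the smallest subspace containing $X$. Exchange Property (EP): for all $X\subseteq P$ and $x,y\in P$, if $y\in\langle X\cup\{x\}\rangle$ but $y\notin\langle X\rangle$, then $x\in\langle X\cup\{y\}\rangle$. A chain of subspaces is a set of subspaces totally ordered by inclusion. $\mathfrak{C}(\Gamma)$ is the family of all chains of subspaces of $\Gamma$; $\mathfrak{W}(\Gamma)\subseteq\mathfrak{C}(\Gamma)$ is the family of those chains that are well ordered by inclusion. Maximality in $\mathfrak{C}(\Gamma)$ or $\mathfrak{W}(\Gamma)$ is with respect to inclusion of chains (as sets of subspaces). *)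

(* Defs.v *)
From mathcomp Require Import all_boot all_order.
From mathcomp Require Import boolp classical_sets wochoice.

Set Implicit Arguments.
Unset Strict Implicit.
Unset Printing Implicit Defensive.

Local Open Scope classical_set_scope.

Record pointLineGeometry := PointLineGeometry {
  point :> Type;
  lines : set (set point);
  point_nonempty : [set: point] !=set0;
  lines_two_points :
    forall l, lines l -> exists x y, [/\ l x, l y & x <> y]
}.

Section Subspaces.
Variable G : pointLineGeometry.
Implicit Types (S X : set G) (C : set (set G)).

Definition subspace S : Prop :=
  forall l, lines l ->
    (exists x y, [/\ (l `&` S) x, (l `&` S) y & x <> y]) -> l `<=` S.

Definition span X : set G := smallest subspace X.

Lemma subspace_span X : subspace (span X).
Proof.
move=> l Ll [x [y [[lx Sx] [ly Sy] xy]]] z lz M [SM XM].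
by apply: (SM l Ll) => //; exists x, y; split=> //; split=> //;
  [apply: Sx|apply: Sy].
Qed.

Definition exchange_property : Prop :=
  forall X (x y : G),
    span (X `|` [set x]) y -> ~ span X y -> span (X `|` [set y]) x.

Definition subspace_chains : set (set (set G)) :=
  [set C | C `<=` subspace /\ total_on C subset].

(* On [set G], [<=%O] is the boolean form of inclusion (see [subsetEset]). *)
Definition wo_subspace_chains : set (set (set G)) :=
  [set C | subspace_chains C /\ wo_chain <=%O (mem C)].

End Subspaces.

Arguments exchange_property : clear implicits.
Arguments subspace_chains : clear implicits.
Arguments wo_subspace_chains : clear implicits.

Definition maximal_member (T : Type) (F : set (set T)) (C : set T) : Prop :=
  F C /\ forall D, F D -> C `<=` D -> D = C.

(* Main.v *)
(* Adjoining one element to a well ordered chain, comparable with all of its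
   members, again gives a well ordered chain. Hence a subspace belonging to a
   chain that extends a maximal well ordered chain already belongs to the
   latter. *)
Require Import Defs.
From mathcomp Require Import all_boot all_order.
From mathcomp Require Import boolp classical_sets wochoice.

Import Order.POrderTheory.
Local Open Scope classical_set_scope.
Local Open Scope order_scope.

(** For a nonempty [A] inside the enlarged chain, if [A] without [x] is nonempty it has a minimum
    [m] by well-ordering of [C]. The least element of [A] is then [m], or the smaller of [x] and [m]
    when [x] lies in [A]. *)
Lemma wo_chain_predU1 {d : Order.disp_t} {T : porderType d} (C : {pred T})
    (x : T) :
  {in C, forall y, x >=< y} ->
  wo_chain <=%O C -> wo_chain <=%O [predU1 x & C].
Proof.
(* Antisymmetry makes minima unique, so only existence is left to prove. *)
move=> xC woC; apply: antisymmetric_wo_chain => [y z _ _|A sAC [a Aa]].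
  exact: le_anti.
have [[b Bb]|noB] := pselect (nonempty [predD1 A & x]); last first.
  have Ax y : y \in A -> y = x.
    move=> Ay; apply/eqP/negPn/negP => yx; apply: noB; exists y.
    by rewrite inE /= yx.
  by exists x; split=> [|y /Ax ->//]; rewrite -(Ax a).
have sBC y : y \in [predD1 A & x] -> y \in C.
  by rewrite !inE => /andP[yx /sAC]; rewrite inE /= (negPf yx).
have [m [[Bm lbm] _]] : exists! m, minimum_of <=%O [predD1 A & x] m.
  by apply: woC; [exact: sBC | exists b].
have Am : m \in A by move: Bm; rewrite !inE => /andP[].
have lbA y : y \in A -> y != x -> m <= y.
  by move=> Ay yx; apply: lbm; rewrite inE /= yx.
have [Ax|nAx] := boolP (x \in A); last first.
  by exists m; split=> // y Ay; apply: lbA => //; apply: contraNneq nAx => <-.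
case/orP: (xC m (sBC m Bm)) => [xm|mx].
  exists x; split=> // y Ay.
  by have [->//|yx] := eqVneq y x; exact/(le_trans xm)/lbA.
by exists m; split=> // y Ay; have [->//|yx] := eqVneq y x; exact: lbA.
Qed.

Theorem corollary3p4 (G : pointLineGeometry) (EP : exchange_property G)
    (C : set (set G)) :
  maximal_member (wo_subspace_chains G) C ->
  maximal_member (subspace_chains G) C.
Proof.
move=> [[chC woC] maxC]; split=> // D [subD totD] sCD.
apply/seteqP; split=> // X DX.
have sXD : X |` C `<=` D by move=> Y [->|/sCD].
suff <- : X |` C = C by left.
apply: maxC => [|Y CY]; last by right.
split; first by split=> [Y /sXD/subD//|Y Z /sXD DY /sXD]; exact: totD.
have xC : {in mem C, forall Y, X >=< Y}.
  move=> Y; rewrite inE => /sCD DY; apply/orP.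
  by case: (totD X Y DX DY) => ?; [left|right]; apply/subsetPset.
(* [wo_chain] only constrains subsets, so it transfers from the boolean predicate [[predU1 X & C]]
   to the set with the same members. *)
move=> A sA; apply: (wo_chain_predU1 _ _ xC woC) => Y /sA.
by rewrite !inE => -[->|CY]; apply/orP; [left|right; rewrite inE].
Qed.
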